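(* For every integer $j \geq 3$, $$m_j(B, C_4) = \begin{cases} 4 & \text{if } j = 3,\\ 3 & \text{if } j = 4,\\ 2 & \text{if } j \in \{5,6\},\\ 1 & \text{otherwise.}\end{cases}$$
   Context: All graphs are simple. $K_{j\times s}$ denotes the complete multipartite graph with $j$ partite sets, each of size $s$. The Butterfly graph $B$ is the graph on 5 vertices consisting of two copies of the triangle $C_3$ sharing exactly one common vertex. $C_4$ denotes the cycle on 4 vertices. For graphs $B$ and $G$ and an integer $j\ge 2$, the size multipartite Ramsey number $m_j(B,G)$ is the smallest natural number $s$ such that every colouring of the edges of $K_{j\times s}$ with two colours, red and blue, contains a red copy of $B$ or a blue copy of $G$; if no such $s$ exists, $m_j(B,G)=\infty$. *)

(* Defs.v *)
From HB Require Import structures.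
From mathcomp Require Import all_boot.
From mathcomp Require Import boolp.

Set Implicit Arguments.
Unset Strict Implicit.
Unset Printing Implicit Defensive.

Record sgraph := SGraph {
  vertex :> finType;
  adj : rel vertex;
  adj_sym : symmetric adj;
  adj_irrefl : irreflexive adj
}.

(* G contains a (not necessarily induced) copy of H. *)
Definition contains (G H : sgraph) : bool :=
  [exists f : {ffun H -> G},
    injectiveb f && [forall x, forall y, adj x y ==> adj (f x) (f y)]].

Section Multipartite.
Variables j s : nat.

Definition multipartite_adj : rel ('I_j * 'I_s) := fun u v => u.1 != v.1.

Lemma multipartite_sym : symmetric multipartite_adj.
Proof. by move=> u v; rewrite /multipartite_adj eq_sym. Qed.

Lemma multipartite_irrefl : irreflexive multipartite_adj.
Proof. by move=> u; rewrite /multipartite_adj eqxx. Qed.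

(* K_{j x s}; the first component of a vertex is the index of its part. *)
Definition complete_multipartite : sgraph :=
  SGraph multipartite_sym multipartite_irrefl.

End Multipartite.

(* A 2-colouring assigns a boolean to each unordered pair of vertices; only its
   values on the pairs [set x; y] with adj x y are ever used. *)
Definition coloring (G : sgraph) := {ffun {set G} -> bool}.

Section ColorClass.
Variables (G : sgraph) (c : coloring G) (b : bool).

Definition color_adj : rel G := fun x y => adj x y && (c [set x; y] == b).

Lemma color_sym : symmetric color_adj.
Proof. by move=> x y; rewrite /color_adj adj_sym setUC. Qed.

Lemma color_irrefl : irreflexive color_adj.
Proof. by move=> x; rewrite /color_adj adj_irrefl. Qed.

Definition color_class : sgraph := SGraph color_sym color_irrefl.

End ColorClass.

Definition red (G : sgraph) (c : coloring G) : sgraph := color_class c true.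
Definition blue (G : sgraph) (c : coloring G) : sgraph := color_class c false.

Definition arrows (K H G : sgraph) : bool :=
  [forall c : coloring K, contains (red c) H || contains (blue c) G].

(* m_j(H, G), with None standing for infinity. *)
Definition size_multipartite_ramsey (j : nat) (H G : sgraph) : option nat :=
  match pselect (exists s, arrows (complete_multipartite j s) H G) with
  | left ex_s => Some (ex_minn ex_s)
  | right _ => None
  end.

(* The two triangles are {0,1,2} and {0,3,4}. *)
Definition butterfly_adj : rel 'I_5 := fun x y =>
  (x != y) &&
  (((val x \in [:: 0; 1; 2]) && (val y \in [:: 0; 1; 2])) ||
   ((val x \in [:: 0; 3; 4]) && (val y \in [:: 0; 3; 4]))).

Lemma butterfly_sym : symmetric butterfly_adj.
Proof.
by move=> x y; rewrite /butterfly_adj eq_sym; congr (_ && (_ || _)); rewrite andbC.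
Qed.

Lemma butterfly_irrefl : irreflexive butterfly_adj.
Proof. by move=> x; rewrite /butterfly_adj eqxx. Qed.

Definition butterfly : sgraph := SGraph butterfly_sym butterfly_irrefl.

Definition C4_adj : rel 'I_4 := fun x y => (y == ordS x) || (x == ordS y).

Lemma C4_sym : symmetric C4_adj.
Proof. by move=> x y; rewrite /C4_adj orbC. Qed.

Lemma C4_irrefl : irreflexive C4_adj.
Proof. by case=> [[|[|[|[|]]]] h]. Qed.

Definition C4 : sgraph := SGraph C4_sym C4_irrefl.

(* Main.v *)
(* Arrowing is monotone in both [j] and [s], so everything follows from the
   positive cases K_{7x1}, K_{5x2}, K_{4x3}, K_{3x4} and from explicit colourings
   of K_{6x1}, K_{4x2}, K_{3x3}.  For a positive case, sort the vertices of each
   part, and the parts themselves, so that the red neighbours of one fixed vertex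
   come first; splitting on edge colours then refutes every colouring in a few
   thousand steps.  An unverified search finds the tree of splits, and the kernel
   replays it. *)

Require Import Defs.
From Corelib Require Import BinNums.
From mathcomp Require Import all_boot.
From mathcomp Require Import boolp.

Set Implicit Arguments.
Unset Strict Implicit.
Unset Printing Implicit Defensive.

(** * Subgraph containment and monotonicity of arrowing *)

Lemma containsP (G H : sgraph) :
  reflect (exists2 f : H -> G, injective f & {homo f : x y / adj x y})
          (contains G H).
Proof.
apply: (iffP existsP) => [[f /andP[/injectiveP f_inj /forallP f_adj]]|[f f_inj f_adj]].
  by exists f => // x y; exact/implyP/(forallP (f_adj x)).
exists [ffun x => f x]; apply/andP; split.
  by apply/injectiveP => x y; rewrite !ffunE => /f_inj.
by apply/forallP => x; apply/forallP => y; rewrite !ffunE; apply/implyP/f_adj.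
Qed.

Lemma contains_trans (G H K : sgraph) (f : G -> K) :
  injective f -> {homo f : x y / adj x y} -> contains G H -> contains K H.
Proof.
move=> f_inj f_adj /containsP[g g_inj g_adj]; apply/containsP; exists (f \o g).
  exact: inj_comp.
by move=> x y /g_adj/f_adj.
Qed.

(** A colouring of [L] pulls back along the embedding [f] to one of [K], and [f] carries
    monochromatic copies forward with their colour. *)
Lemma arrows_trans (K L H G : sgraph) (f : K -> L) :
  injective f -> {homo f : x y / adj x y} -> arrows K H G -> arrows L H G.
Proof.
move=> f_inj f_adj /forallP arrKHG; apply/forallP => c.
pose c' : coloring K := [ffun A : {set K} => c (f @: A)].
have sub b X : contains (color_class c' b) X -> contains (color_class c b) X.
  apply: (@contains_trans (color_class c' b) X (color_class c b) f) => // x y.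
  by case/andP=> /f_adj xy; rewrite ffunE imsetU1 imset_set1 /= /color_adj xy.
by case/orP: (arrKHG c') => /sub ->; rewrite ?orbT.
Qed.

Lemma arrows_multipartite_mono (j j' s s' : nat) (H G : sgraph) :
  j <= j' -> s <= s' -> arrows (complete_multipartite j s) H G ->
  arrows (complete_multipartite j' s') H G.
Proof.
move=> jj' ss'.
apply: (@arrows_trans (complete_multipartite j s) (complete_multipartite j' s') H G
          (fun x => (widen_ord jj' x.1, widen_ord ss' x.2))).
  by move=> [p i] [q k] [/val_inj/= -> /val_inj/= ->].
by move=> x y; apply: contraNneq => -[/val_inj ->].
Qed.

(** By monotonicity in the part size, failure at [s] excludes every size up to [s]. *)
Lemma size_multipartite_ramseyS (j s : nat) (H G : sgraph) :
  arrows (complete_multipartite j s.+1) H G ->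
  ~~ arrows (complete_multipartite j s) H G ->
  size_multipartite_ramsey j H G = Some s.+1.
Proof.
move=> arrS; rewrite /size_multipartite_ramsey; case: pselect => [ex|[]]; last by exists s.+1.
move=> narr; congr Some; case: ex_minnP => m arrm minm.
apply/eqP; rewrite eqn_leq minm //= ltnNge; apply: contra narr => ms.
exact: arrows_multipartite_mono (leqnn _) ms arrm.
Qed.

(** Adjacent vertices differ by irreflexivity, so distinct opposite vertices make all four
    distinct. *)
Lemma contains_C4 (G : sgraph) (a b c d : G) :
  a != c -> b != d -> adj a b -> adj b c -> adj c d -> adj d a -> contains G C4.
Proof.
move=> ac bd ab bc cd da; apply/containsP.
have ne x y : @adj G x y -> x != y by apply: contraTneq => ->; rewrite adj_irrefl.
have abcd : uniq [:: a; b; c; d].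
  by rewrite /= !inE !negb_or ac bd (ne a b) // (ne b c) // (ne c d) // eq_sym ne.
exists (fun i : 'I_4 => nth a [:: a; b; c; d] i).
  by move=> x y /eqP; rewrite nth_uniq // => /eqP/val_inj.
case=> [[|[|[|[|]]]] //= ?]; case=> [[|[|[|[|]]]] //= ?] //=;
  by rewrite /C4_adj -?val_eqE //= 1?adj_sym.
Qed.

Lemma contains_butterfly (G : sgraph) (v a b c d : G) :
  uniq [:: a; b; c; d] -> adj v a -> adj v b -> adj v c -> adj v d ->
  adj a b -> adj c d -> contains G butterfly.
Proof.
move=> abcd va vb vc vd ab cd; apply/containsP.
have ne x y : @adj G x y -> x != y by apply: contraTneq => ->; rewrite adj_irrefl.
have vabcd : uniq [:: v; a; b; c; d].
  by rewrite cons_uniq abcd !inE !negb_or !ne.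
exists (fun i : 'I_5 => nth v [:: v; a; b; c; d] i).
  by move=> x y /eqP; rewrite nth_uniq // => /eqP/val_inj.
case=> [[|[|[|[|[|]]]]] //= ?]; case=> [[|[|[|[|[|]]]]] //= ?] //=;
  by rewrite /butterfly_adj -?val_eqE //= 1?adj_sym.
Qed.

Lemma C4_in (G : sgraph) : contains G C4 ->
  exists a b c d : G, [&& a != c, b != d, adj a b, adj b c, adj c d & adj d a].
Proof.
case/containsP=> f f_inj f_adj.
exists (f (@Ordinal 4 0 isT)), (f (@Ordinal 4 1 isT)),
       (f (@Ordinal 4 2 isT)), (f (@Ordinal 4 3 isT)).
by rewrite !(inj_eq f_inj) !f_adj.
Qed.

Lemma butterfly_in (G : sgraph) : contains G butterfly ->
  exists v a b c d : G, [&& uniq [:: a; b; c; d], adj v a, adj v b, adj v c,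
                           adj v d, adj a b & adj c d].
Proof.
case/containsP=> f f_inj f_adj.
exists (f (@Ordinal 5 0 isT)), (f (@Ordinal 5 1 isT)), (f (@Ordinal 5 2 isT)),
       (f (@Ordinal 5 3 isT)), (f (@Ordinal 5 4 isT)).
by rewrite /= !inE !(inj_eq f_inj) !f_adj.
Qed.

(** * Lower bounds: explicit colourings, given by their blue edges and checked by computation *)

Section LowerBound.
Variables (j s : nat) (E : seq (nat * nat)).

Definition blue_edge a b := ((a, b) \in E) || ((b, a) \in E).

Definition has_blue_C4 :=
  let V := iota 0 (j * s) in
  let e a b := (a %/ s != b %/ s) && blue_edge a b in
  has (fun a => has (fun b => e a b && has (fun c => [&& a != c, e b c &
    has (fun d => [&& b != d, e c d & e d a]) V]) V) V) V.

Definition has_red_butterfly :=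
  let V := iota 0 (j * s) in
  let e a b := (a %/ s != b %/ s) && ~~ blue_edge a b in
  has (fun v => let N := [seq x <- V | e v x] in
    has (fun a => has (fun b => e a b && has (fun c =>
    has (fun d => e c d && uniq [:: a; b; c; d]) N) N) N) N) V.

Let K := complete_multipartite j s.

(* Unlike the labels of the upper bound, codes number the vertices part by part. *)
Definition code (x : K) := x.1 * s + x.2.

Lemma code_part x : code x %/ s = x.1.
Proof.
have s_gt0 : 0 < s by apply: leq_ltn_trans (ltn_ord x.2).
by rewrite /code divnMDl // divn_small ?addn0 ?ltn_ord.
Qed.

Lemma code_inj : injective code.
Proof.
move=> x y xy; have x1y1 := congr1 (divn^~ s) xy; rewrite !code_part in x1y1.
case: x y x1y1 xy => [p i] [q k] /= /val_inj ->.
by rewrite /code /= => /addnI/val_inj ->.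
Qed.

Lemma code_in x : code x \in iota 0 (j * s).
Proof.
rewrite mem_iota /= add0n (leq_trans (n := x.1.+1 * s)) ?leq_mul2r ?ltn_ord ?orbT //.
by rewrite mulSnr /code ltn_add2l.
Qed.

(** The colour has to be read off the unordered set [A], hence the quantification over both ends;
    [x != y] keeps a diagonal pair in [E] from affecting it. *)
Definition coloring_of : coloring K :=
  [ffun A : {set K} => [forall x in A, forall y in A,
                          (x != y) ==> ~~ blue_edge (code x) (code y)]].

Lemma coloring_ofE x y :
  x != y -> coloring_of [set x; y] = ~~ blue_edge (code x) (code y).
Proof.
move=> xy; rewrite ffunE; apply/idP/idP.
  move/forall_inP/(_ x (set21 _ _))/forall_inP/(_ y (set22 _ _)).
  by rewrite xy.
move=> nb; apply/forall_inP => u /set2P[] ->; apply/forall_inP => w /set2P[] ->;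
  by rewrite ?eqxx ?nb ?implybT // /blue_edge orbC nb implybT.
Qed.

Lemma blueE x y : @adj (blue coloring_of) x y =
  (code x %/ s != code y %/ s) && blue_edge (code x) (code y).
Proof.
rewrite !code_part /= /color_adj /= /multipartite_adj -val_eqE.
have [->|xy] := eqVneq x y; first by rewrite eqxx.
by rewrite coloring_ofE // eqbF_neg negbK.
Qed.

Lemma redE x y : @adj (red coloring_of) x y =
  (code x %/ s != code y %/ s) && ~~ blue_edge (code x) (code y).
Proof.
rewrite !code_part /= /color_adj /= /multipartite_adj -val_eqE.
have [->|xy] := eqVneq x y; first by rewrite eqxx.
by rewrite coloring_ofE // eqb_id.
Qed.

(** The injection [code] sends a monochromatic copy to numbers below [j * s], where the exhaustive
    tests would find it. *)
Lemma not_arrows : ~~ (has_blue_C4 || has_red_butterfly) ->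
  ~~ arrows K butterfly C4.
Proof.
apply: contra => /forallP/(_ coloring_of) /orP[] copy; apply/orP.
  right; have [v [a [b [c [d /and5P[abcd va vb vc /and3P[vd ab cd]]]]]]] := butterfly_in copy.
  rewrite !redE in va vb vc vd ab cd.
  have N x : (code v %/ s != code x %/ s) && ~~ blue_edge (code v) (code x) ->
      code x \in [seq y <- iota 0 (j * s) |
                   (code v %/ s != y %/ s) && ~~ blue_edge (code v) y].
    by rewrite mem_filter => ->; exact: code_in.
  apply/hasP; exists (code v); first exact: code_in.
  apply/hasP; exists (code a); first exact: N.
  apply/hasP; exists (code b); rewrite ?N ?ab //=.
  apply/hasP; exists (code c); first exact: N.
  apply/hasP; exists (code d); rewrite ?N ?cd //.
  by move: abcd; rewrite -(map_inj_uniq code_inj).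
left; have [a [b [c [d /and5P[ac bd ab bc /andP[cd da]]]]]] := C4_in copy.
rewrite !blueE in ab bc cd da.
apply/hasP; exists (code a); first exact: code_in.
apply/hasP; exists (code b); rewrite ?code_in ?ab //.
apply/hasP; exists (code c); rewrite ?code_in ?bc // (inj_eq code_inj) ac.
by apply/hasP; exists (code d); rewrite ?code_in ?cd // (inj_eq code_inj) bd da.
Qed.

End LowerBound.

(** Blue is two disjoint triangles and red is the bipartite graph between them. *)
Lemma not_arrows_6_1 : ~~ arrows (complete_multipartite 6 1) butterfly C4.
Proof.
by apply: (@not_arrows 6 1 [:: (0, 1); (0, 2); (1, 2); (3, 4); (3, 5); (4, 5)]); vm_compute.
Qed.

(** The red triangles are 047, 247, 135 and 136: any two share an edge or are disjoint. No two
    vertices have two common blue neighbours. *)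
Lemma not_arrows_4_2 : ~~ arrows (complete_multipartite 4 2) butterfly C4.
Proof.
by apply: (@not_arrows 4 2
  [:: (0, 2); (0, 3); (0, 6); (1, 2); (1, 4); (1, 7); (3, 7); (4, 6); (5, 6); (5, 7)]);
  vm_compute.
Qed.

(** The red triangles are 148, 158 and 236: the first two share an edge, and the third is disjoint
    from both. *)
Lemma not_arrows_3_3 : ~~ arrows (complete_multipartite 3 3) butterfly C4.
Proof.
by apply: (@not_arrows 3 3
  [:: (0, 3); (0, 4); (0, 5); (1, 3); (1, 6); (1, 7);
      (2, 4); (2, 7); (2, 8); (3, 8); (4, 7); (5, 6)]); vm_compute.
Qed.

Lemma not_arrows_0 j : ~~ arrows (complete_multipartite j 0) butterfly C4.
Proof.
apply/forallPn; exists [ffun=> true]; rewrite negb_or.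
by apply/andP; split; apply/containsP => -[f _ _]; case: (f ord0) => _ [].
Qed.

(* A tree of case distinctions on the colours of edges; [Split (e, b) t u] goes
   on with [t] if [e] has colour [b] and with [u] otherwise.  A leaf names a
   constraint that is violated on its branch. *)
Inductive refutation (A : Type) :=
  | Conflict of A
  | Split of N * bool & refutation A & refutation A.

(** * Search for a refutation, always splitting on a shortest clause *)

Section Search.
Variable A : Type.
Implicit Types (v : N) (b : bool) (c : seq (N * bool)).
Implicit Types F : seq (A * seq (N * bool)).

(* [None] stands for a clause that has become true. *)
Fixpoint assign_clause v b c :=
  if c isn't (w, b') :: c' then Some [::] else
  if N_eqb v w then if b (+) b' then assign_clause v b c' else None
  else if assign_clause v b c' is Some d then Some ((w, b') :: d) else None.

Definition assign v b F :=
  pmap (fun k => omap (pair k.1) (assign_clause v b k.2)) F.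

Fixpoint shorter c1 c2 :=
  match c1, c2 with
  | _, [::] => false
  | [::], _ => true
  | _ :: c1', _ :: c2' => shorter c1' c2'
  end.

(* Each clause of [F] carries the name of the constraint from which it comes. *)
Fixpoint search n F : option (refutation A) :=
  if n isn't n'.+1 then None else
  if F isn't k0 :: F' then None else
  let k := foldl (fun k1 k2 => if shorter k2.2 k1.2 then k2 else k1) k0 F' in
  if k.2 isn't (v, b) :: c then Some (Conflict k.1) else
  if search n' (assign v b F) isn't Some t then None else
  (* For a unit clause, the opposite colour violates it at once. *)
  if c is [::] then Some (Split (v, b) t (Conflict k.1)) else
  if search n' (assign v (~~ b) F) is Some u then Some (Split (v, b) t u)
  else None.

End Search.

(** * Soundness of the replay of a refutation *)

Section Check.
Variables (A : Type) (valid : pred A) (clause : A -> seq (N * bool)).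

Fixpoint refutes (path : seq (N * bool)) t :=
  match t with
  | Conflict k => valid k && all (fun l => has (fun l' =>
                    N_eqb l.1 l'.1 && (l.2 (+) l'.2)) path) (clause k)
  | Split l t u => refutes (l :: path) t && refutes ((l.1, ~~ l.2) :: path) u
  end.

(** A valuation follows one branch of the tree down to a leaf. The clause named there has a true
    literal, yet the true literals of the path contradict all its literals. *)
Lemma refutesP (val : N -> bool) t :
  (forall k, valid k -> has (fun l => val l.1 == l.2) (clause k)) ->
  ~~ refutes [::] t.
Proof.
move=> sat; suff: forall path, all (fun l => val l.1 == l.2) path -> ~~ refutes path t.
  exact.
elim: t => [k|[e b] t IHt u IHu] path pathP /=; apply/negP => /andP[].
  move=> /sat/hasP[l lk /eqP vl] /allP/(_ l lk)/hasP[l' /(allP pathP)/eqP vl'].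
  by case/andP=> /eq_binP le; rewrite -vl -vl' le addbb.
move=> rt ru; have [ve|ve] := eqVneq (val e) b.
  by apply/negP: rt; rewrite IHt //= ve eqxx.
by apply/negP: ru; rewrite IHu //= pathP andbT; case: (val e) (b) ve => -[].
Qed.

End Check.

(* The label [a < j * s] stands for vertex number [a %/ j] of part [a %% j].
   [Sorted_at a b] says that if the edge from 0 to [b] is red, so is the one from
   0 to [a]; this breaks the symmetry between vertices of the same part
   ([b = a + j]) and between the parts other than part 0 ([b = a + 1]). *)
Inductive constraint :=
  | C4_at of nat & nat & nat & nat
  | Butterfly_at of nat & nat & nat & nat & nat
  | Sorted_at of nat & nat.

(** * The constraints as clauses over edge colours *)

Section Constraints.
Variables j s : nat.

(** Both orders of a pair give the same variable; quotient and remainder by [j * s] recover its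
    ends. *)
Definition edge a b := bin_of_nat (minn a b * (j * s) + maxn a b).

Definition across a b := a %% j != b %% j.

Definition clause k :=
  match k with
  | C4_at a b c d =>
      [:: (edge a b, true); (edge b c, true); (edge c d, true); (edge d a, true)]
  | Butterfly_at v a b c d =>
      [:: (edge v a, false); (edge v b, false); (edge v c, false);
          (edge v d, false); (edge a b, false); (edge c d, false)]
  | Sorted_at a b => [:: (edge 0 b, false); (edge 0 a, true)]
  end.

(** In [Sorted_at], the residue conditions leave out part 0, which holds the fixed vertex, and stop
    [a.+1] from wrapping around to the next position. *)
Definition valid k :=
  match k with
  | C4_at a b c d =>
      [&& all (gtn (j * s)) [:: a; b; c; d], a != c, b != d,
          across a b, across b c, across c d & across d a]
  | Butterfly_at v a b c d =>
      [&& all (gtn (j * s)) [:: v; a; b; c; d], uniq [:: a; b; c; d],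
          all (across v) [:: a; b; c; d], across a b & across c d]
  | Sorted_at a b =>
      [&& b < j * s, a %% j != 0, b %% j != 0 & (b == a + j) || (b == a.+1)]
  end.

(* The decreasing order of [V] matters only for the speed of the search. *)
Definition constraints :=
  let V := rev (iota 0 (j * s)) in
  (* The order conditions here and below list each 4-cycle and each butterfly only once. *)
  let opposite a c := [seq b <- V | [&& a < b, across a b & across c b]] in
  let triangles v := [seq (a, b) | a <- V, b <- [seq b <- V |
                        [&& a < b, across v a, across v b & across a b]]] in
  [seq k <- flatten [seq [:: Sorted_at a (a + j); Sorted_at a a.+1] | a <- V] | valid k]
  ++ flatten [seq [seq Butterfly_at v t.1 t.2 u.1 u.2 |
                     t <- triangles v, u <- [seq u <- triangles v |
                       [&& t.1 < u.1, u.1 != t.2 & u.2 != t.2]]] |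
                v <- V]
  ++ flatten [seq [seq C4_at a b c d |
                     b <- opposite a c, d <- [seq d <- opposite a c | b < d]] |
                a <- V, c <- [seq c <- V | a < c]].

(** Each split decides a new edge, so fuel exceeding the number of edges suffices. *)
Definition search_refutation :=
  search (j * s * (j * s)) [seq (k, clause k) | k <- constraints].

End Constraints.

(** * Upper bounds: a labelling adapted to the colouring satisfies all constraints *)

Section UpperBound.
Variables (j' s' : nat).
Let j := j'.+1.
Let s := s'.+1.
Let K := complete_multipartite j s.
Variable c : coloring K.

Let root : K := (ord0, ord0).
Let is_red p (i : 'I_s) := c [set root; ((p, i) : K)].
Let redness p := count (is_red p) (enum 'I_s).

Definition parts : seq 'I_j :=
  ord0 :: sort (fun p q => redness q <= redness p) [seq p <- enum 'I_j | p != ord0].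

Definition members (p : 'I_j) : seq 'I_s :=
  if p == ord0 then enum 'I_s else
  [seq i <- enum 'I_s | is_red p i] ++ [seq i <- enum 'I_s | ~~ is_red p i].

Definition part_of a := nth ord0 parts (a %% j).

Definition label a : K := (part_of a, nth ord0 (members (part_of a)) (a %/ j)).

Lemma parts_perm : perm_eq parts (enum 'I_j).
Proof.
apply: uniq_perm; rewrite ?enum_uniq //=.
  by rewrite mem_sort mem_filter eqxx sort_uniq filter_uniq ?enum_uniq.
by move=> p; rewrite inE mem_sort mem_filter mem_enum andbT orbN.
Qed.

Lemma size_parts : size parts = j.
Proof. by rewrite (perm_size parts_perm) size_enum_ord. Qed.

Lemma uniq_parts : uniq parts.
Proof. by rewrite (perm_uniq parts_perm) enum_uniq. Qed.

Lemma members_perm p : perm_eq (members p) (enum 'I_s).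
Proof. by rewrite /members; case: ifP => // _; rewrite perm_filterC. Qed.

Lemma size_members p : size (members p) = s.
Proof. by rewrite (perm_size (members_perm p)) size_enum_ord. Qed.

Lemma uniq_members p : uniq (members p).
Proof. by rewrite (perm_uniq (members_perm p)) enum_uniq. Qed.

Lemma part_of_eq a b : (part_of a == part_of b) = (a %% j == b %% j).
Proof. by rewrite nth_uniq ?uniq_parts ?size_parts ?ltn_pmod. Qed.

Lemma label_across a b : @adj K (label a) (label b) = across j a b.
Proof. by rewrite /= /multipartite_adj /= part_of_eq. Qed.

Lemma label_inj : {in gtn (j * s) &, injective label}.
Proof.
move=> a b; rewrite !inE mulnC => an bn [/eqP].
rewrite part_of_eq => ab; have/eqP -> : part_of a == part_of b by rewrite part_of_eq.
move/eqP; rewrite nth_uniq ?uniq_members ?size_members ?ltn_divLR // => /eqP ab'.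
by rewrite (divn_eq a j) (divn_eq b j) ab' (eqP ab).
Qed.

Lemma label0 : label 0 = root.
Proof.
rewrite /label /part_of mod0n div0n /= /members eqxx /root; congr (_, _).
by apply: val_inj; rewrite /= nth_enum_ord.
Qed.

(** Outside part 0, [members] puts the red neighbours of the root first, and [redness] counts
    them. *)
Lemma is_red_label a : a < j * s -> a %% j != 0 ->
  c [set label 0; label a] = (a %/ j < redness (part_of a)).
Proof.
rewrite mulnC => an a0; rewrite label0 -[c _]/(is_red _ _).
have -> : members (part_of a) = [seq i <- enum 'I_s | is_red (part_of a) i] ++
                               [seq i <- enum 'I_s | ~~ is_red (part_of a) i].
  by rewrite /members -[ord0]/(part_of 0) part_of_eq mod0n (negPf a0).
rewrite nth_cat size_filter -/(redness _); case: ltnP => ar.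
  have := mem_nth ord0 (s := [seq i <- enum 'I_s | is_red (part_of a) i]).
  by move/(_ (a %/ j)); rewrite size_filter mem_filter => /(_ ar)/andP[].
have := mem_nth ord0 (s := [seq i <- enum 'I_s | ~~ is_red (part_of a) i]).
move/(_ (a %/ j - redness (part_of a))); rewrite mem_filter => sz.
apply: negbTE; apply: (proj1 (andP (sz _))).
rewrite ltn_subLR // size_filter [redness _ + _]count_predC size_enum_ord.
by rewrite ltn_divLR.
Qed.

(** The two residues are consecutive and nonzero, so they index neighbouring entries of the sorted
    tail of [parts]. *)
Lemma redness_parts a : a %% j != 0 -> a.+1 %% j != 0 ->
  redness (part_of a.+1) <= redness (part_of a).
Proof.
move=> a0 a1; have aS : a.+1 %% j = (a %% j).+1.
  rewrite -addn1 -modnDml addn1 modn_small // ltn_neqAle ltn_pmod // andbT.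
  by apply: contraNneq a1 => aj; rewrite -addn1 -modnDml addn1 aj modnn.
rewrite /part_of aS; case: (a %% j) a0 aS => // m _ aS /=.
set r := fun p q => _; set ps := sort _ _.
have : sorted r ps by apply: sort_sorted => p q; exact: leq_total.
move/(sortedP ord0); apply; have szps : (size ps).+1 = j := size_parts.
by rewrite -ltnS szps -aS ltn_pmod.
Qed.

(** From [a] to [a + j] the part stays and the position grows; from [a] to [a.+1] the position does
    not drop and [redness] does not grow. Redness of the later edge thus passes to the earlier
    one. *)
Lemma label_sorted a b : valid j s (Sorted_at a b) ->
  c [set label 0; label b] -> c [set label 0; label a].
Proof.
case/and4P=> bn a0 b0 ab; have an : a < j * s.
  by apply: ltn_trans bn; case/orP: ab => /eqP-> //; rewrite -addn1 leq_add2l.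
rewrite !is_red_label //; case/orP: ab => /eqP bE; subst b.
  rewrite divnDr // divnn /= addn1 => /ltnW.
  suff /eqP-> : part_of (a + j) == part_of a by [].
  by rewrite part_of_eq modnDr.
move/leq_trans => /(_ _ (redness_parts a0 b0)).
by apply: leq_ltn_trans; exact: leq_div2r.
Qed.

Hypothesis no_red : ~~ contains (red c) butterfly.
Hypothesis no_blue : ~~ contains (blue c) C4.

Definition edge_color (e : N) := c [set label (e %/ (j * s)); label (e %% (j * s))].

Lemma edge_colorE a b : a < j * s -> b < j * s ->
  edge_color (edge j s a b) = c [set label a; label b].
Proof.
move=> an bn; rewrite /edge_color bin_of_natK.
rewrite divnMDl ?muln_gt0 // modnMDl divn_small ?modn_small ?gtn_max ?an //.
by rewrite addn0 /minn /maxn; case: ltnP => // _; rewrite setUC.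
Qed.

(** A false cycle or butterfly clause would yield a forbidden copy through [label]; the sorting
    clauses hold by the choice of [label]. *)
Lemma clause_sat k : valid j s k ->
  has (fun l => edge_color l.1 == l.2) (clause j s k).
Proof.
have neq a b : a < j * s -> b < j * s -> a != b -> label a != label b.
  by move=> an bn; apply: contraNneq => /label_inj ->.
case: k => [a b c0 d|v a b c0 d|a b].
- case/and4P=> /and5P[an bn cn dn _] ac bd /and4P[ab bc cd da].
  rewrite /= !edge_colorE // orbF; apply: contraNT no_blue.
  rewrite !negb_or !eqb_id => /and4P[cab cbc ccd cda].
  apply: (@contains_C4 (blue c) (label a) (label b) (label c0) (label d));
    rewrite ?neq // /= /color_adj label_across;
    by rewrite ?ab ?bc ?cd ?da eqbF_neg.
- case/and5P=> /and5P[vn an bn cn /andP[dn _]] abcd /and5P[va vb vc vd _] ab cd.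
  rewrite /= !edge_colorE // orbF; apply: contraNT no_red.
  rewrite !negb_or !eqbF_neg !negbK => /and5P[cva cvb cvc cvd /andP[cab ccd]].
  apply: (@contains_butterfly (red c) (label v) (label a) (label b) (label c0) (label d));
    rewrite /= /color_adj ?label_across ?eqb_id ?va ?vb ?vc ?vd ?ab ?cd //.
  rewrite -[_ && _]/(uniq (map label [:: a; b; c0; d])) map_inj_in_uniq //.
  by apply: sub_in2 label_inj => x; rewrite !inE => /or4P[] /eqP->.
move=> ab; have := label_sorted ab; case/and4P: ab => bn _ _ ab.
have an : a < j * s.
  by apply: ltn_trans bn; case/orP: ab => /eqP-> //; rewrite -addn1 leq_add2l.
by rewrite /= !edge_colorE //; case: (c _) => //= ->.
Qed.

End UpperBound.

(** * Computed certificates and the final case distinction *)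

Definition certifies j s (o : option (refutation constraint)) :=
  if o is Some t then refutes (valid j s) (clause j s) [::] t else false.

(** A colouring without either copy would make its [edge_color] a valuation satisfying every valid
    clause. *)
Lemma arrows_certified j s o : certifies j.+1 s.+1 o ->
  arrows (complete_multipartite j.+1 s.+1) butterfly C4.
Proof.
case: o => // t /= tP; apply/forallP => c; apply/norP => -[no_red no_blue].
by have /negP := refutesP t (clause_sat no_red no_blue).
Qed.

(* Evaluated here, so that only the tree is part of the proofs below. *)
Definition refutation_7_1 := Eval vm_compute in search_refutation 7 1.
Definition refutation_5_2 := Eval vm_compute in search_refutation 5 2.
Definition refutation_4_3 := Eval vm_compute in search_refutation 4 3.
Definition refutation_3_4 := Eval vm_compute in search_refutation 3 4.

Lemma arrows_7_1 : arrows (complete_multipartite 7 1) butterfly C4.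
Proof. by apply: (@arrows_certified 6 0 refutation_7_1); vm_compute. Qed.

Lemma arrows_5_2 : arrows (complete_multipartite 5 2) butterfly C4.
Proof. by apply: (@arrows_certified 4 1 refutation_5_2); vm_compute. Qed.

Lemma arrows_4_3 : arrows (complete_multipartite 4 3) butterfly C4.
Proof. by apply: (@arrows_certified 3 2 refutation_4_3); vm_compute. Qed.

Lemma arrows_3_4 : arrows (complete_multipartite 3 4) butterfly C4.
Proof. by apply: (@arrows_certified 2 3 refutation_3_4); vm_compute. Qed.

Theorem theorem3p9 (j : nat) (hj : 3 <= j) :
  size_multipartite_ramsey j butterfly C4 =
    Some (if j == 3 then 4
          else if j == 4 then 3
          else if j \in [:: 5; 6] then 2
          else 1).
Proof.
move: j hj => [|[|[|[|[|[|[|j]]]]]]] // _.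
- exact: size_multipartite_ramseyS arrows_3_4 not_arrows_3_3.
- exact: size_multipartite_ramseyS arrows_4_3 not_arrows_4_2.
(* For five parts, the failure of size 1 is inherited from six parts. *)
- apply: size_multipartite_ramseyS; first exact: arrows_5_2.
  exact: contra (arrows_multipartite_mono _ _) not_arrows_6_1.
- apply: size_multipartite_ramseyS not_arrows_6_1.
  exact: arrows_multipartite_mono arrows_5_2.
(* Here [j] counts the parts beyond seven; parts of size 0 leave no vertices. *)
apply: size_multipartite_ramseyS (not_arrows_0 _).
exact: arrows_multipartite_mono arrows_7_1.
Qed.
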